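(* For an integer $n \geq 3$, let $\psi: \mathcal{BM}^2_s \to \mathcal{BM}^n_s$ be the mapping defined by \[ \psi(X) = X \oplus_1 \ell_1^{n-2} \quad \text{for } X \in \mathcal{BM}^2_s. \] Suppose for $X \in \mathcal{BM}^2_s \setminus \{\ell_1^2\}$ that $X_1, X_2 \in \mathcal{BM}^2_s$ satisfy $d_{BM}(X, X_i) \leq d_{BM}(X, \ell_1^2)^{\frac{1}{3}}$ for $i=1, 2$. Then \[ d_{BM}(\psi(X_1), \psi(X_2)) = d_{BM}(X_1, X_2). \] In particular, $\psi$ is a local isometric embedding of $(\mathcal{BM}^2_s \setminus \{\ell_1^2\}, d_{BM})$ into $(\mathcal{BM}^n_s, d_{BM})$.
   Context: $\ell_1^n$ denotes $\mathbb{R}^n$ with the norm $\|x\|_1 = \sum_i |x_i|$. For normed spaces $X, Y$, the sum $X \oplus_1 Y$ is $X \times Y$ with norm $\|(x,y)\| = \|x\|_X + \|y\|_Y$. The Banach--Mazur distance between two real normed spaces $X, Y$ of the same finite dimension is $d_{BM}(X,Y) = \inf \|T\|\,\|T^{-1}\|$, the infimum over all invertible linear operators $T: X \to Y$, with operator norms. The symmetric Banach--Mazur compactum $\mathcal{BM}^n_s$ is the set of (linear) isometry classes of $n$-dimensional real normed spaces, equipped with the multiplicative metric $d_{BM}$ (i.e. $\log d_{BM}$ is a metric). A map is a local isometric embedding if every point of its domain has a neighbourhood on which the map preserves all distances. *)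

(* Defs.v *)
From HB Require Import structures.
From mathcomp Require Import all_boot all_order all_algebra.
From mathcomp Require Import all_classical all_reals all_analysis.
Set Implicit Arguments.
Unset Strict Implicit.
Unset Printing Implicit Defensive.
Import Order.TTheory GRing.Theory Num.Theory numFieldNormedType.Exports.
Local Open Scope classical_set_scope.
Local Open Scope ring_scope.

(* The library puts the sup norm on 'rV[R]_n and on products, so the
   l1-normed versions live on aliases of these types. *)
Definition ell1 (R : realType) (n : nat) : Type := 'rV[R]_n.

Section Ell1.
Variables (R : realType) (n : nat).

HB.instance Definition _ := GRing.Lmodule.copy (ell1 R n) 'rV[R]_n.

Definition ell1_norm (x : ell1 R n) : R :=
  \sum_(i < n) `|(x : 'rV[R]_n) ord0 i|.

Lemma ell1_normD (x y : ell1 R n) :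
  ell1_norm (x + y) <= ell1_norm x + ell1_norm y.
Proof.
rewrite /ell1_norm -big_split /=; apply: ler_sum => i _.
by rewrite mxE ler_normD.
Qed.

Lemma ell1_normZ (l : R) (x : ell1 R n) :
  ell1_norm (l *: x) = `|l| * ell1_norm x.
Proof. by rewrite /ell1_norm mulr_sumr; apply: eq_bigr => i _; rewrite mxE normrM. Qed.

Lemma ell1_norm0_eq0 (x : ell1 R n) : ell1_norm x = 0 -> x = 0.
Proof.
move=> x0; apply/rowP => i; rewrite mxE; apply/eqP; rewrite -normr_eq0.
by move/eqP: x0; rewrite psumr_eq0 // => /allP/(_ i); rewrite mem_index_enum; apply.
Qed.

HB.instance Definition _ :=
  Lmodule_isNormed.Build R (ell1 R n) ell1_normD ell1_normZ ell1_norm0_eq0.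

End Ell1.

Definition l1sum (X Y : Type) : Type := (X * Y)%type.

Section L1sum.
Variables (R : realType) (X Y : normedModType R).

HB.instance Definition _ := GRing.Lmodule.copy (l1sum X Y) (X * Y)%type.

Definition l1sum_norm (p : l1sum X Y) : R := `|p.1| + `|p.2|.

Lemma l1sum_normD (p q : l1sum X Y) :
  l1sum_norm (p + q) <= l1sum_norm p + l1sum_norm q.
Proof. by rewrite /l1sum_norm addrACA lerD // ler_normD. Qed.

Lemma l1sum_normZ (l : R) (p : l1sum X Y) :
  l1sum_norm (l *: p) = `|l| * l1sum_norm p.
Proof. by rewrite /l1sum_norm mulrDr !normrZ. Qed.

Lemma l1sum_norm0_eq0 (p : l1sum X Y) : l1sum_norm p = 0 -> p = 0.
Proof.
case: p => x y /eqP; rewrite /l1sum_norm paddr_eq0 // !normr_eq0 /=.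
by move=> /andP[/eqP-> /eqP->].
Qed.

HB.instance Definition _ :=
  Lmodule_isNormed.Build R (l1sum X Y) l1sum_normD l1sum_normZ l1sum_norm0_eq0.

End L1sum.

Notation "X \oplus_1 Y" := (l1sum X Y) (at level 50, left associativity).

Section BanachMazur.
Variable R : realType.
Implicit Types X Y Z : normedModType R.

Definition has_dim X (n : nat) : Prop :=
  exists f : {linear X -> 'rV[R]_n}, bijective f.

(* The supremum is over a bounded set whenever X is finite-dimensional, the only
   case in which this is used. *)
Definition opnorm X Y (T : {linear X -> Y}) : R :=
  sup [set `|T x| | x in [set x : X | `|x| <= 1]].

Definition BM_dist X Y : R :=
  inf [set d | exists (T : {linear X -> Y}) (Tinv : {linear Y -> X}),
         [/\ cancel T Tinv, cancel Tinv T & d = opnorm T * opnorm Tinv]].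

Definition isometric X Y : Prop :=
  exists2 T : {linear X -> Y}, bijective T & forall x, `|T x| = `|x|.

Lemma linear_inv X Y (T : {linear X -> Y}) : bijective T ->
  exists2 S : {linear Y -> X}, cancel T S & cancel S T.
Proof.
case=> g Tg gT.
have glin : linear g by move=> a x y; apply: (can_inj Tg); rewrite linearP !gT.
pose S : {linear Y -> X} := HB.pack g (GRing.isLinear.Build R Y X *:%R g glin).
by exists S.
Qed.

Lemma isometric_inv X Y : isometric X Y ->
  exists (T : {linear X -> Y}) (S : {linear Y -> X}),
    [/\ cancel T S, cancel S T, forall x, `|T x| = `|x| & forall y, `|S y| = `|y|].
Proof.
case=> T /linear_inv[S TS ST] Tn; exists T, S; split => // y.
by rewrite -Tn ST.
Qed.

Lemma isometric_refl X : isometric X X.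
Proof. by exists idfun => //; exists idfun. Qed.

Lemma isometric_sym X Y : isometric X Y -> isometric Y X.
Proof. by case/isometric_inv => T [S [TS ST _ Sn]]; exists S => //; exists T. Qed.

Lemma isometric_trans X Y Z : isometric X Y -> isometric Y Z -> isometric X Z.
Proof.
case=> T bT Tn [U bU Un]; exists (U \o T); first exact: bij_comp.
by move=> x /=; rewrite Un Tn.
Qed.

Lemma opnorm_isometric X X' Y Y' (T : {linear X -> Y})
    (A : {linear X' -> X}) (A' : {linear X -> X'}) (B : {linear Y -> Y'}) :
  cancel A' A -> (forall x, `|A x| = `|x|) -> (forall y, `|B y| = `|y|) ->
  opnorm (B \o T \o A) = opnorm T.
Proof.
move=> AK An Bn; congr sup; apply/seteqP; split=> r [x /= x1 <-].
  by exists (A x); rewrite /= ?An ?Bn.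
by exists (A' x); rewrite /= ?Bn ?AK // -An AK.
Qed.

Lemma BM_dist_isometric X X' Y Y' : isometric X X' -> isometric Y Y' ->
  BM_dist X Y = BM_dist X' Y'.
Proof.
suff H U U' V V' : isometric U U' -> isometric V V' ->
    [set d | exists (T : {linear U -> V}) (Tinv : {linear V -> U}),
       [/\ cancel T Tinv, cancel Tinv T & d = opnorm T * opnorm Tinv]] `<=`
    [set d | exists (T : {linear U' -> V'}) (Tinv : {linear V' -> U'}),
       [/\ cancel T Tinv, cancel Tinv T & d = opnorm T * opnorm Tinv]].
  move=> iX iY; congr inf; apply/seteqP; split; first exact: H.
  by apply: H; exact: isometric_sym.
case/isometric_inv => A [A' [AK A'K An A'n]].
case/isometric_inv => B [B' [BK B'K Bn B'n]].
move=> d [T [S [TS ST ->]]].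
exists (B \o T \o A'), (A \o S \o B'); split.
- by move=> x /=; rewrite BK TS A'K.
- by move=> x /=; rewrite AK ST B'K.
- by rewrite (@opnorm_isometric _ _ _ _ T A' A B) // (@opnorm_isometric _ _ _ _ S B' B A).
Qed.

Lemma l1sum_isometric X X' Z : isometric X X' ->
  isometric (X \oplus_1 Z) (X' \oplus_1 Z).
Proof.
case/isometric_inv => T [S [TS ST Tn Sn]].
pose f (p : X \oplus_1 Z) : X' \oplus_1 Z := (T p.1, p.2).
have flin : linear f.
  by move=> a p q; rewrite /f /= linearP.
pose F : {linear (X \oplus_1 Z) -> (X' \oplus_1 Z)} :=
  HB.pack f (GRing.isLinear.Build R _ _ *:%R f flin).
exists F.
  exists (fun p => (S p.1, p.2)) => [[x z]|[x z]] /=.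
    by rewrite /F /= /f /= TS.
  by rewrite /F /= /f /= ST.
by move=> p; rewrite /Num.norm /= /l1sum_norm /= Tn.
Qed.

Lemma has_dim_ell1 n : has_dim (ell1 R n) n.
Proof. by exists idfun; exists idfun. Qed.

Lemma has_dim_l1sum X Y m k : has_dim X m -> has_dim Y k ->
  has_dim (X \oplus_1 Y) (m + k).
Proof.
case=> f [f' fK f'K] [g [g' gK g'K]].
pose h (p : X \oplus_1 Y) : 'rV[R]_(m + k) := row_mx (f p.1) (g p.2).
have hlin : linear h.
  by move=> a p q; rewrite /h !linearP /= scale_row_mx add_row_mx.
pose H : {linear (X \oplus_1 Y) -> 'rV[R]_(m + k)} :=
  HB.pack h (GRing.isLinear.Build R _ _ *:%R h hlin).
exists H; exists (fun v => (f' (lsubmx v), g' (rsubmx v))) => [[x y]|v] /=.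
  by rewrite /H /= /h /= row_mxKl row_mxKr fK gK.
by rewrite /H /= /h /= f'K g'K hsubmxK.
Qed.

Record fdspace (n : nat) := FDSpace {
  fdspace_sort :> normedModType R;
  fdspaceP : has_dim fdspace_sort n }.

(* normedModType R lives in a universe too large for eqType, choiceType and hence
   {eq_quot _}, so isometry classes are predicates on fdspace n. *)
Record BM (n : nat) := IsomClass {
  BM_mem :> fdspace n -> Prop;
  BM_memP : exists X : fdspace n, BM_mem = (fun Y : fdspace n => isometric X Y) }.

Definition isom_class n (X : fdspace n) : BM n :=
  @IsomClass n (fun Y : fdspace n => isometric X Y) (ex_intro _ X erefl).

Lemma isom_classP n (X Y : fdspace n) :
  isom_class X = isom_class Y <-> isometric X Y.
Proof.
split=> [[/(congr1 (@^~ Y)) ->]|XY]; first exact: isometric_refl.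
have E : (fun Z : fdspace n => isometric X Z) = (fun Z : fdspace n => isometric Y Z).
  apply: functional_extensionality_dep => Z.
  apply: propositional_extensionality; split; last exact: isometric_trans.
  by apply: isometric_trans; exact: isometric_sym.
rewrite /isom_class; move: (ex_intro _ X _) (ex_intro _ Y _).
by rewrite E => p q; congr IsomClass; exact: Prop_irrelevance.
Qed.

Lemma isom_class_surj n (C : BM n) : exists X : fdspace n, C = isom_class X.
Proof.
case: C => C p; case: (p) => X CX; exists X; subst C.
by congr IsomClass; exact: Prop_irrelevance.
Qed.

Definition isom_repr n (C : BM n) : fdspace n := projT1 (cid (isom_class_surj C)).

Lemma isom_reprK n (C : BM n) : isom_class (isom_repr C) = C.
Proof. by rewrite /isom_repr; case: (cid _) => X /= ->. Qed.

Lemma isom_repr_isometric n (X : fdspace n) : isometric (isom_repr (isom_class X)) X.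
Proof. by apply/isom_classP; rewrite isom_reprK. Qed.

Definition d_BM n (X Y : BM n) : R := BM_dist (isom_repr X) (isom_repr Y).

Lemma d_BM_class n (X Y : fdspace n) :
  d_BM (isom_class X) (isom_class Y) = BM_dist X Y.
Proof. by apply: BM_dist_isometric; exact: isom_repr_isometric. Qed.

Definition ell1_space (n : nat) : fdspace n := FDSpace (has_dim_ell1 n).

Definition BM_ell1 (n : nat) : BM n := isom_class (ell1_space n).

Section Psi.
Variables (n : nat) (hn : (3 <= n)%N).

Lemma has_dim_psi (X : fdspace 2) : has_dim (X \oplus_1 ell1 R (n - 2)) n.
Proof.
rewrite -[n in X in _ X](subnKC (ltnW hn)).
exact: has_dim_l1sum (fdspaceP X) (has_dim_ell1 _).
Qed.

Definition psi_space (X : fdspace 2) : fdspace n := FDSpace (has_dim_psi X).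

Definition psi (X : BM 2) : BM n := isom_class (psi_space (isom_repr X)).

Lemma psi_class (X : fdspace 2) : psi (isom_class X) = isom_class (psi_space X).
Proof. by apply/isom_classP; apply: l1sum_isometric; exact: isom_repr_isometric. Qed.

End Psi.

(* Neighbourhoods are taken for multiplicative metrics dA and dB (whose
   logarithms are metrics), hence balls of radius r > 1; D, with the induced
   metric, is the domain of f. *)
Definition local_isometric_embedding (A B : Type) (dA : A -> A -> R)
    (dB : B -> B -> R) (D : A -> Prop) (f : A -> B) : Prop :=
  forall x, D x -> exists2 r : R, 1 < r &
    forall y z, D y -> D z -> dA x y < r -> dA x z < r ->
      dB (f y) (f z) = dA y z.

End BanachMazur.

(* Main.v *)
Require Import Defs.
From HB Require Import structures.
From mathcomp Require Import all_boot all_order all_algebra.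
From mathcomp Require Import all_classical all_reals all_analysis.
From mathcomp Require Import ring lra.
Set Implicit Arguments.
Unset Strict Implicit.
Unset Printing Implicit Defensive.
Import Order.TTheory GRing.Theory Num.Theory numFieldNormedType.Exports.
Local Open Scope classical_set_scope.
Local Open Scope ring_scope.

(* Write T : X1 + l1^m -> X2 + l1^m with |p| <= |T p| <= D |p| and D <= 2, and look at
   the scalar entries c_ij = (T e_j)_i.  If some |c_ij| >= 1, then c_ij carries at
   least half of the norm of T e_j, so pivoting on it (a Schur complement) gives a map
   X1 + l1^(m-1) -> X2 + l1^(m-1) with the same bounds.  If all |c_ij| < 1, fix i and
   let f be the X1-component of T^-1 e_i: for v in X1 with (T v)_i = 0 one gets
   D |v + f| >= |v| + |f|, so X1 is D-close to l1^2.  Hence D >= d(X1, X2) or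
   D >= d(X1, l1^2).  The restriction D <= 2 is harmless because every plane is at
   distance at most 2 from l1^2 (Auerbach), and the cube root in the hypothesis makes
   d(X1, X2) <= d(X1, l1^2) by the triangle inequality. *)

(** * Boundedness, compactness and invertibility in finite dimension *)

Section FiniteDimension.
Variable R : realType.
Implicit Types X Y Z : normedModType R.

Lemma linear_rV_bounded X n (g : {linear 'rV[R]_n -> X}) :
  exists2 C, 0 < C & forall v, `|g v| <= C * `|v|.
Proof.
exists (1 + \sum_(i < n) `|g (delta_mx 0 i)|).
  by rewrite ltr_pwDl// sumr_ge0.
move=> v; rewrite {1}(row_sum_delta v) linear_sum /=.
apply: (le_trans (ler_norm_sum _ _ _)).
rewrite mulrDl mul1r mulr_suml ler_wpDl//; apply: ler_sum => i _.
rewrite linearZ /= normrZ mulrC ler_wpM2l//.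
by rewrite [leRHS]/Num.norm /= mx_normrE; apply/bigmax_geP; right; exists (0, i).
Qed.

Lemma has_dim_linear_bij X n : has_dim X n ->
  exists (f : {linear X -> 'rV[R]_n}) (g : {linear 'rV[R]_n -> X}),
    cancel f g /\ cancel g f.
Proof. by case=> f /linear_inv[g fg gf]; exists f, g. Qed.

(** By compactness [|g v|] attains a positive minimum on the unit sphere of ['rV[R]_n], and its
    inverse bounds [f]. *)
Lemma linear_coord_bounded X n (f : {linear X -> 'rV[R]_n})
    (g : {linear 'rV[R]_n -> X}) : cancel g f -> cancel f g ->
  exists2 C, 0 < C & forall x, `|f x| <= C * `|x|.
Proof.
move=> gf fg; have [C C0 gC] := linear_rV_bounded g.
pose S := [set v : 'rV[R]_n | `|v| = 1].
have [S0|/nonemptyPn S0] := pselect (S !=set0); last first.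
  (* If the sphere is empty, no [f x] can be normalised, so [f] vanishes and any constant works. *)
  exists 1 => // x; suff -> : f x = 0 by rewrite normr0 mul1r.
  apply: contrapT => /eqP fx0; suff: S (`|f x|^-1 *: f x) by rewrite S0.
  by rewrite /S /= normrZ normfV normr_id mulVf// normr_eq0.
have cg : continuous (fun v => `|g v|).
  move=> v; apply: (@continuous_comp _ _ _ g (@Num.norm R X)).
    apply: bounded_linear_continuous; apply/linear_boundedP.
    exists C; split=> [|r Cr x]; first exact: num_real.
    by rewrite (le_trans (gC x))// ler_wpM2r// ltW.
  exact: norm_continuous.
have cS : compact S.
  apply: bounded_closed_compact.
    by exists 1; split => // r r1 v /= ->; rewrite ltW.
  rewrite (_ : S = (@Num.norm R 'rV[R]_n) @^-1` [set 1])//.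
  apply: closed_comp => [v _|]; first exact: norm_continuous.
  exact: closed_eq.
have [v /set_mem/= v1 vmin] :=
  EVT_min_rV S0 cS (continuous_subspaceT cg).
have gv0 : 0 < `|g v|.
  rewrite normr_gt0; apply/eqP => /(congr1 f); rewrite gf linear0 => v0.
  by move: v1; rewrite /S /= v0 normr0 => /esym/eqP; rewrite oner_eq0.
exists `|g v|^-1; first by rewrite invr_gt0.
move=> x; have [->|fx0] := eqVneq (f x) 0.
  by rewrite normr0 mulr_ge0.
have : `|g v| <= `|g (`|f x|^-1 *: f x)|.
  apply: vmin; rewrite inE /S /= normrZ normfV normr_id mulVf//.
  by rewrite normr_eq0.
rewrite linearZ /= fg normrZ normfV normr_id.
by rewrite ler_pdivlMl ?normr_gt0// => H; rewrite ler_pdivlMl // mulrC.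
Qed.

Lemma linear_fd_bounded X Y n (T : {linear X -> Y}) : has_dim X n ->
  exists2 C, 0 < C & forall x, `|T x| <= C * `|x|.
Proof.
case/has_dim_linear_bij => f [g [fg gf]].
have [C C0 fC] := linear_coord_bounded gf fg.
have [D D0 TD] := linear_rV_bounded (T \o g).
exists (D * C) => [|x]; first exact: mulr_gt0.
by rewrite -{1}(fg x) (le_trans (TD _))// -mulrA ler_wpM2l// ltW.
Qed.

(** In coordinates the sequence stays in a compact ball. This later yields a limit of
    near-isometries. *)
Lemma bounded_seq_cluster X n (u : nat -> X) (M : R) : has_dim X n ->
  (forall k, `|u k| <= M) ->
  exists p, forall e, 0 < e -> forall k, exists2 j, (k <= j)%N & `|u j - p| < e.
Proof.
case/has_dim_linear_bij => f [g [fg gf]] uM.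
have [C C0 fC] := linear_coord_bounded gf fg.
have [D D0 gD] := linear_rV_bounded g.
pose B := [set v : 'rV[R]_n | `|v| <= C * M].
have cB : compact B.
  apply: bounded_closed_compact.
    exists (C * M); split => [|r r1 v /= vB]; first exact: num_real.
    by rewrite (le_trans vB)// ltW.
  rewrite (_ : B = (@Num.norm R 'rV[R]_n) @^-1` [set x | x <= C * M])//.
  apply: closed_comp => [v _|]; first exact: norm_continuous.
  exact: closed_le.
have uB k : B (f (u k)).
  by rewrite /B /= (le_trans (fC _))// ler_wpM2l// ltW.
have [|p [_ pcl]] := cB ((fun k => f (u k)) @ \oo) _.
  by exists 0%N => // k _; exact: uB.
exists (g p) => e e0 k.
have tail : ((fun k => f (u k)) @ \oo) [set f (u j) | j in [set j | (k <= j)%N]].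
  by exists k => // j /= kj; exists j.
have pe : nbhs p (ball p (e / D)) by apply: nbhsx_ballx; rewrite divr_gt0.
have [y [[j /= kj <-] pj]] := pcl _ _ tail pe.
exists j => //.
rewrite -(fg (u j)) -linearB (le_lt_trans (gD _))// -ltr_pdivlMl//.
move: pj; rewrite -ball_normE /= distrC => /lt_le_trans; apply.
by rewrite mulrC.
Qed.

(** The coordinate matrix has trivial kernel and is square, hence invertible. This supplies the
    inverse that [distortion_le] does not mention. *)
Lemma linear_inj_bij X Y n (T : {linear X -> Y}) : has_dim X n ->
  has_dim Y n -> injective T -> bijective T.
Proof.
move=> /has_dim_linear_bij[f [f' [fK f'K]]] /has_dim_linear_bij[h [h' [hK h'K]]] Ti.
pose M := lin1_mx (h \o T \o f').
have ME v : v *m M = h (T (f' v)) by rewrite mul_rV_lin1.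
have Mu : M \in unitmx.
  rewrite -row_free_unit -kermx_eq0; apply/eqP/row_matrixP => i.
  rewrite row0; apply: (can_inj f'K); apply: Ti; apply: (can_inj hK).
  by rewrite -ME -row_mul mulmx_ker row0 !linear0.
exists (fun y => f' (h y *m invmx M)) => [x|y].
  by rewrite -{1}(fK x) -ME mulmxK.
by apply: (can_inj hK); rewrite -ME mulmxKV.
Qed.

End FiniteDimension.

(** * Distortion bounds and their relation to [BM_dist] *)

Section Distortion.
Variable R : realType.
Implicit Types X Y Z : normedModType R.

(* |T| |T^-1| <= D after rescaling T; invertibility is left to the dimensions. *)
Definition distortion_le X Y (D : R) : Prop :=
  exists T : {linear X -> Y}, forall x, `|x| <= `|T x| <= D * `|x|.

Lemma norm_l1sum X Y (p : X \oplus_1 Y) : `|p| = `|p.1| + `|p.2|.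
Proof. by []. Qed.

Lemma norm_ell1 m (x : ell1 R m) :
  `|x| = \sum_(i < m) `|(x : 'rV[R]_m) ord0 i|.
Proof. by []. Qed.

Lemma expanding_bij X Y n (T : {linear X -> Y}) : has_dim X n -> has_dim Y n ->
  (forall x, `|x| <= `|T x|) -> bijective T.
Proof.
move=> Xn Yn Tx; apply: (linear_inj_bij Xn Yn) => x y Txy.
apply/eqP; rewrite -subr_eq0 -normr_le0 (le_trans (Tx _))//.
by rewrite linearB Txy subrr normr0.
Qed.

Lemma has_dim_neq0 X n : has_dim X n -> (0 < n)%N -> exists x : X, 0 < `|x|.
Proof.
case: n => // n /has_dim_linear_bij[f [g [fg gf]]] _.
exists (g (const_mx 1)); rewrite normr_gt0; apply/eqP => /(congr1 f).
rewrite gf linear0 => /matrixP/(_ 0 0); rewrite !mxE => /eqP.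
by rewrite oner_eq0.
Qed.

Lemma distortion_ge1 X Y n D : has_dim X n -> (0 < n)%N ->
  distortion_le X Y D -> 1 <= D.
Proof.
move=> Xn n0 [T TD]; have [x x0] := has_dim_neq0 Xn n0.
have /andP[/le_trans h1 /h1] := TD x.
by rewrite -{1}[`|x|]mul1r ler_pM2r.
Qed.

(** The inverse of [T], multiplied by [D], satisfies the same two bounds. *)
Lemma distortion_le_sym X Y n D : 0 <= D -> has_dim X n -> has_dim Y n ->
  distortion_le X Y D -> distortion_le Y X D.
Proof.
move=> D0 Xn Yn [T TD].
have Te x : `|x| <= `|T x| by have /andP[] := TD x.
have [S TS ST] := linear_inv (expanding_bij Xn Yn Te).
exists (D \*: S) => y /=; rewrite normrZ ger0_norm// -{1}(ST y).
by have /andP[Sy ->] := TD (S y); rewrite ler_wpM2l// -{2}(ST y).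
Qed.

Lemma distortion_le_trans X Y Z D E : 0 <= E ->
  distortion_le X Y D -> distortion_le Y Z E -> distortion_le X Z (D * E).
Proof.
move=> E0 [T TD] [U UE]; exists (U \o T) => x /=.
have /andP[Tx TxD] := TD x; have /andP[Ux UxE] := UE (T x).
by rewrite (le_trans Tx Ux) (le_trans UxE)// [D * E]mulrC -mulrA ler_wpM2l.
Qed.

Lemma opnorm_ge X Y n (T : {linear X -> Y}) x : has_dim X n ->
  `|T x| <= opnorm T * `|x|.
Proof.
move=> Xn; have [C C0 TC] := linear_fd_bounded T Xn.
have [->|x0] := eqVneq x 0; first by rewrite linear0 !normr0 mulr0.
rewrite -ler_pdivrMr ?normr_gt0//.
apply: ub_le_sup.
  exists C => _ [z /= z1 <-]; rewrite (le_trans (TC z))//.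
  by rewrite -[leRHS]mulr1 ler_wpM2l// ltW.
exists (`|x|^-1 *: x) => /=.
  by rewrite normrZ normfV normr_id mulVf ?normr_eq0.
by rewrite linearZ normrZ normfV normr_id mulrC.
Qed.

Lemma opnorm_le X Y (T : {linear X -> Y}) C : 0 <= C ->
  (forall x, `|T x| <= C * `|x|) -> opnorm T <= C.
Proof.
move=> C0 TC; apply: ge_sup; first by exists `|T 0|, 0; rewrite //= normr0.
move=> _ [z /= z1 <-]; rewrite (le_trans (TC z))//.
by rewrite -[leRHS]mulr1 ler_wpM2l.
Qed.

Lemma opnorm_ge0 X Y (T : {linear X -> Y}) : 0 <= opnorm T.
Proof.
have [sT|/sup_out sT] := pselect (has_sup [set `|T x| | x in [set x : X | `|x| <= 1]]).
  by apply: (ub_le_sup sT.2); exists 0; rewrite /= ?linear0 normr0.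
(* A set without a supremum has [sup] equal to 0 by convention. *)
by rewrite /opnorm sT.
Qed.

Lemma BM_dist_le X Y n D : 0 <= D -> has_dim X n -> has_dim Y n ->
  distortion_le X Y D -> BM_dist X Y <= D.
Proof.
move=> D0 Xn Yn [T TD].
have Te x : `|x| <= `|T x| by have /andP[] := TD x.
have [S TS ST] := linear_inv (expanding_bij Xn Yn Te).
have TS_D : opnorm T * opnorm S <= D.
  rewrite -[leRHS]mulr1 ler_pM ?opnorm_ge0//.
    by apply: opnorm_le => // x; have /andP[] := TD x.
  apply: opnorm_le => // y; rewrite mul1r -{2}(ST y).
  by have /andP[] := TD (S y).
apply: le_trans TS_D; apply: ge_inf.
  by exists 0 => _ [T' [S' [_ _ ->]]]; rewrite mulr_ge0// opnorm_ge0.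
by exists T, S.
Qed.

Lemma lt_BM_dist X Y n D : (0 < n)%N -> has_dim X n -> has_dim Y n ->
  BM_dist X Y < D -> distortion_le X Y D.
Proof.
move=> n0 Xn Yn /inf_lt[|_ [T [S [TS ST ->]]] TSD].
  (* The infimum is over a nonempty set: coordinates give an isomorphism. *)
  have [f [f' [fK f'K]]] := has_dim_linear_bij Xn.
  have [h [h' [hK h'K]]] := has_dim_linear_bij Yn.
  eexists; exists (h' \o f), (f' \o h); split; last reflexivity.
    by move=> x /=; rewrite h'K fK.
  by move=> x /=; rewrite f'K hK.
(* Scaling by [opnorm S] turns [|x| <= opnorm S * |T x|] into the required lower bound. *)
exists (opnorm S \*: T) => x /=; rewrite normrZ ger0_norm ?opnorm_ge0//.
rewrite -{1}(TS x) (opnorm_ge S _ Yn)/=.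
apply: (@le_trans _ _ (opnorm S * (opnorm T * `|x|))).
  by rewrite ler_wpM2l ?opnorm_ge0// (opnorm_ge _ _ Xn).
by rewrite mulrA [X in X * _]mulrC ler_wpM2r// ltW.
Qed.

End Distortion.

(** * Removing the common [ell1] summand coordinate by coordinate *)

Section Elimination.
Variable R : realType.
Implicit Types X Y : normedModType R.

(** The codomain [R^o] is the field as a module over itself, so that coordinates compose with linear
    maps. *)
Definition l1coord X m (i : 'I_m) (p : X \oplus_1 ell1 R m) : R^o :=
  (p.2 : 'rV[R]_m) ord0 i.

Fact l1coord_linear X m i : linear (@l1coord X m i).
Proof. by move=> a p q; rewrite /l1coord /= !mxE. Qed.

HB.instance Definition _ X m i :=
  GRing.isLinear.Build R (X \oplus_1 ell1 R m) R^o *:%R (@l1coord X m i)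
    (@l1coord_linear X m i).

Lemma l1coordB X m (i : 'I_m) (p q : X \oplus_1 ell1 R m) :
  l1coord i (p - q) = l1coord i p - l1coord i q :> R.
Proof. by rewrite /l1coord /= !mxE. Qed.

Lemma l1coordZ X m (i : 'I_m) a (p : X \oplus_1 ell1 R m) :
  l1coord i (a *: p) = a * l1coord i p :> R.
Proof. by rewrite /l1coord /= !mxE. Qed.

Definition drop_coord X m (i : 'I_m.+1) (p : X \oplus_1 ell1 R m.+1) :
    X \oplus_1 ell1 R m :=
  (p.1, col' i (p.2 : 'rV[R]_m.+1)).

Fact drop_coord_linear X m i : linear (@drop_coord X m i).
Proof. by move=> a p q; rewrite /drop_coord /= linearP. Qed.

HB.instance Definition _ X m i :=
  GRing.isLinear.Build R (X \oplus_1 ell1 R m.+1) (X \oplus_1 ell1 R m) *:%R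
    (@drop_coord X m i) (@drop_coord_linear X m i).

(** [unlift j k] is [None] exactly at [k = j], where the default 0 is inserted. *)
Definition pad_coord X m (j : 'I_m.+1) (p : X \oplus_1 ell1 R m) :
    X \oplus_1 ell1 R m.+1 :=
  (p.1, \row_k oapp ((p.2 : 'rV[R]_m) ord0) 0 (unlift j k)).

Fact pad_coord_linear X m j : linear (@pad_coord X m j).
Proof.
move=> a p q; congr pair; apply/rowP => k; rewrite !mxE.
by case: unliftP => [l|] _ /=; rewrite ?mxE// mulr0 addr0.
Qed.

HB.instance Definition _ X m j :=
  GRing.isLinear.Build R (X \oplus_1 ell1 R m) (X \oplus_1 ell1 R m.+1) *:%R
    (@pad_coord X m j) (@pad_coord_linear X m j).

Definition unit_coord X m (j : 'I_m) : X \oplus_1 ell1 R m :=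
  (0, delta_mx ord0 j).

Lemma l1coord_unit_coord X m (i j : 'I_m) :
  l1coord i (unit_coord X j) = (i == j)%:R.
Proof. by rewrite /l1coord mxE eqxx. Qed.

Lemma norm_coord_drop X m (i : 'I_m.+1) (p : X \oplus_1 ell1 R m.+1) :
  `|p| = `|drop_coord i p| + `|l1coord i p|.
Proof.
rewrite !norm_l1sum !norm_ell1 (bigD1_ord i)//= [`|_| + \sum_(_ < _) _]addrC addrA.
by congr (_ + _ + _); apply: eq_bigr => k _; rewrite mxE.
Qed.

Lemma pad_coordK X m (j : 'I_m.+1) : cancel (@pad_coord X m j) (drop_coord j).
Proof.
move=> [x z]; congr pair; apply/rowP => k.
by rewrite !mxE liftK.
Qed.

Lemma l1coord_pad_coord X m (j : 'I_m.+1) (p : X \oplus_1 ell1 R m) :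
  l1coord j (pad_coord j p) = 0.
Proof. by rewrite /l1coord /= mxE unlift_none. Qed.

Lemma drop_coord_unit_coord X m (j : 'I_m.+1) :
  drop_coord j (unit_coord X j) = 0.
Proof.
by congr pair; apply/rowP => k; rewrite !mxE (eq_sym (lift j k)) (negPf (neq_lift j k)) andbF.
Qed.

Lemma drop_coordD_unit X m (j : 'I_m.+1) (p : X \oplus_1 ell1 R m.+1) a :
  drop_coord j (p + a *: unit_coord X j) = drop_coord j p.
Proof. by rewrite linearD linearZ /= drop_coord_unit_coord scaler0 addr0. Qed.

Lemma norm_unit_coord X m (j : 'I_m) : `|unit_coord X j| = 1.
Proof.
case: m j => [[]//|m] j.
by rewrite (norm_coord_drop j) drop_coord_unit_coord l1coord_unit_coord eqxx
  normr0 normr1 add0r.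
Qed.

(* The new map is the Schur complement of the pivot c: p is corrected by the
   multiple of the j-th unit vector that cancels the i-th coordinate of the image. *)
Lemma distortion_le_pivot X Y m (D : R) (i j : 'I_m.+1)
    (T : {linear (X \oplus_1 ell1 R m.+1) -> (Y \oplus_1 ell1 R m.+1)}) :
  (forall p, `|p| <= `|T p| <= D * `|p|) ->
  D <= 2 -> 1 <= `|l1coord i (T (unit_coord X j))| ->
  distortion_le (X \oplus_1 ell1 R m) (Y \oplus_1 ell1 R m) D.
Proof.
set c := l1coord i _ => TD D2 c1.
have c0 : c != 0 by rewrite -normr_gt0 (lt_le_trans _ c1).
pose t p := l1coord i (T (pad_coord j p)) / c.
pose f p := drop_coord i (T (pad_coord j p - t p *: unit_coord X j)).
have flin : linear f.
  move=> a p q; rewrite /f -[RHS]linearP -(linearP T); congr (drop_coord _ (T _)).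
  rewrite /t linearP linearP linearP /= mulrDl scalerDl opprD addrACA scalerBr scalerA.
  by rewrite mulrA.
pose F : {linear _ -> _} := HB.pack f (GRing.isLinear.Build R _ _ *:%R f flin).
have fN p : `|f p| = `|T (pad_coord j p - t p *: unit_coord X j)|.
  rewrite [RHS](norm_coord_drop i) linearB linearZ l1coordB l1coordZ -/c divfK//.
  by rewrite subrr normr0 addr0 /f linearB linearZ.
exists F => p; rewrite /F /=; apply/andP; split.
  (* Lower bound: dropping coordinate [j] of the corrected vector gives back [p], so the correction
     does not shorten it. *)
  rewrite fN; have /andP[+ _] := TD (pad_coord j p - t p *: unit_coord X j).
  apply: le_trans; rewrite [leRHS](norm_coord_drop j).
  by rewrite linearB linearZ /= drop_coord_unit_coord scaler0 subr0 pad_coordK lerDl.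
(* Upper bound: the correction costs [|t p|] times the part of [T e_j] outside row [i]. That part is
   at most [2 - |c| <= |c|], so the cost is covered by the dropped entry, of size [|t p| * |c|]. *)
have /andP[_ Tp] := TD (pad_coord j p).
move: Tp; rewrite [`|pad_coord j p|](norm_coord_drop j) pad_coordK l1coord_pad_coord.
rewrite normr0 addr0; apply: le_trans; rewrite [leRHS](norm_coord_drop i).
rewrite /f linearB linearB linearZ linearZ /= (le_trans (ler_normB _ _))// lerD2l normrZ.
rewrite /t normrM normfV -[leRHS]mulr1 -mulrA ler_wpM2l// ler_pdivrMl ?normr_gt0//.
have /andP[_] := TD (unit_coord X j).
rewrite norm_unit_coord (norm_coord_drop i) -/c => h; lra.
Qed.

Definition span2 X (u v : X) (x : ell1 R 2) : X :=
  (x : 'rV[R]_2) ord0 0 *: u + (x : 'rV[R]_2) ord0 1 *: v.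

Fact span2_linear X u v : linear (@span2 X u v).
Proof.
by move=> a x y; rewrite /span2 !mxE !scalerDl scalerDr !scalerA addrACA.
Qed.

HB.instance Definition _ X u v :=
  GRing.isLinear.Build R (ell1 R 2) X *:%R (@span2 X u v) (@span2_linear X u v).

Lemma norm_ell1_2 (x : ell1 R 2) :
  `|x| = `|(x : 'rV[R]_2) ord0 0| + `|(x : 'rV[R]_2) ord0 1|.
Proof.
rewrite norm_ell1 big_ord_recl big_ord1 (_ : lift _ _ = 1)//.
exact: val_inj.
Qed.

(** For a basis [u 0], [u 1], the vector [phi (u 1) *: u 0 - phi (u 0) *: u 1] lies in the kernel.
    It is zero only if [phi] kills the basis, hence [f]. *)
Lemma linear_form_ker X (phi : {linear X -> R^o}) (f : X) : has_dim X 2 ->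
  phi f != 0 -> exists2 v, v != 0 & phi v = 0.
Proof.
move=> /has_dim_linear_bij[h [g [hK gK]]] phif.
pose u i := g (delta_mx 0 i).
exists (phi (u 1) *: u 0 - phi (u 0) *: u 1); last first.
  by rewrite linearB linearZ linearZ; apply/eqP; rewrite subr_eq0; apply/eqP/mulrC.
apply: contra phif => /eqP /(congr1 h).
rewrite linearB !linearZ /= !gK linear0 => /rowP E.
have := E 0; have := E 1; rewrite !mxE /= oppr0 !mulr0 mulrN1 mulr1 add0r addr0 => /eqP.
rewrite oppr_eq0 => /eqP u0 u1.
rewrite -(hK f) (row_sum_delta (h f)) big_ord_recl big_ord1 linearD !linearZ.
rewrite linearD !linearZ /=.
rewrite -/(u _) u0 scaler0 add0r.
by rewrite (_ : lift _ _ = 1) ?u1 ?scaler0//; apply: val_inj.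
Qed.

(* With (f, s) = T^-1 e_i, the map T sends v + l f to T (v, - l s) + l e_i, whose norm
   is at least |v| + l |f| because the entries of the i-th row are at most 1. *)
Lemma distortion_le_ell1 X Y m (D : R) (i : 'I_m.+1) : has_dim X 2 -> has_dim Y 2 ->
    forall T : {linear (X \oplus_1 ell1 R m.+1) -> (Y \oplus_1 ell1 R m.+1)},
  (forall p, `|p| <= `|T p| <= D * `|p|) -> 0 <= D ->
  (forall j, `|l1coord i (T (unit_coord X j))| < 1) ->
  distortion_le (ell1 R 2) X D.
Proof.
move=> X2 Y2 T TD D0 ci.
have Te p : `|p| <= `|T p| by have /andP[] := TD p.
have Xm := has_dim_l1sum X2 (has_dim_ell1 R m.+1).
have Ym := has_dim_l1sum Y2 (has_dim_ell1 R m.+1).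
have [S TS ST] := linear_inv (expanding_bij Xm Ym Te).
pose in1 (x : X) : X \oplus_1 ell1 R m.+1 := (x, 0).
have in1lin : linear in1.
  by move=> a x y; congr pair; apply/rowP => k; rewrite !mxE mulr0 addr0.
pose I1 : {linear X -> X \oplus_1 ell1 R m.+1} :=
  HB.pack in1 (GRing.isLinear.Build R _ _ *:%R in1 in1lin).
(* The kernel of [phi] and the line through [f] will be the two axes of the copy of [ell1 R 2] in
   [X]. *)
pose phi : {linear X -> R^o} := l1coord i \o T \o I1.
set f := (S (unit_coord Y i)).1; set s := (S (unit_coord Y i)).2.
pose q : X \oplus_1 ell1 R m.+1 := (0, s).
set g := l1coord i (T q).
have fs : `|f| + `|s| <= 1.
  by rewrite -(norm_unit_coord Y i) -{1}(ST (unit_coord Y i)) Te.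
have TI1f : T (I1 f) = unit_coord Y i - T q.
  rewrite -{1}(ST (unit_coord Y i)) -linearB; congr (T _).
  by rewrite [S _]surjective_pairing; congr pair; rewrite /= ?subr0// subrr.
have gE : g = \sum_k (s : 'rV[R]_m.+1) ord0 k * l1coord i (T (unit_coord X k)).
  rewrite /g (_ : q = \sum_k (s : 'rV[R]_m.+1) ord0 k *: unit_coord X k).
    by rewrite 2!linear_sum; apply: eq_bigr => k _; rewrite 2!linearZ.
  rewrite [RHS]surjective_pairing; congr pair.
    by rewrite (raddf_sum fst) big1// => k _ /=; rewrite scaler0.
  by rewrite (raddf_sum snd) /= {1}(row_sum_delta (s : 'rV[R]_m.+1)).
have gs : `|g| <= `|s| -
    \sum_k `|(s : 'rV[R]_m.+1) ord0 k| * (1 - `|l1coord i (T (unit_coord X k))|).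
  rewrite norm_ell1 -sumrB gE (le_trans (ler_norm_sum _ _ _))//.
  by apply: ler_sum => k _; rewrite normrM; lra.
have gap0 k : 0 <= `|(s : 'rV[R]_m.+1) ord0 k| * (1 - `|l1coord i (T (unit_coord X k))|).
  by rewrite mulr_ge0// subr_ge0 ltW.
have phif : phi f = 1 - g.
  by rewrite /phi /= -/(I1 f) TI1f linearB /= l1coord_unit_coord eqxx.
(* If [g = 1], then [gs] and [fs] force the sum of gaps to vanish. Each entry of the row is below 1
   in absolute value, so [s = 0] and hence [g = 0]. *)
have phif0 : phi f != 0.
  rewrite phif subr_eq0 eq_sym; apply/eqP => g1.
  have /eqP : \sum_k `|(s : 'rV[R]_m.+1) ord0 k| * (1 - `|l1coord i (T (unit_coord X k))|) = 0.
    apply/le_anti/andP; split; last exact: sumr_ge0.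
    by move: gs fs (normr_ge0 f); rewrite g1 normr1; lra.
  rewrite psumr_eq0// => /allP s0.
  suff g0 : g = 0 by move: g1; rewrite g0 => /esym/eqP; rewrite oner_eq0.
  rewrite gE big1// => k _.
  have /s0 : k \in index_enum 'I_m.+1 by rewrite mem_index_enum.
  rewrite mulf_eq0 normr_eq0 subr_eq0 => /orP[/eqP->|/eqP c1]; first by rewrite mul0r.
  by have := ci k; rewrite -c1 ltxx.
have [v v0 phiv] := linear_form_ker X2 phif0.
have lower (w : X) l : phi w = 0 -> `|w| + `|l| * `|f| <= D * `|w + l *: f|.
  move=> phiw.
  have -> : `|w + l *: f| = `|I1 (w + l *: f)| by rewrite norm_l1sum /= normr0 addr0.
  have /andP[_] := TD (I1 (w + l *: f)); apply: le_trans.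
  rewrite (norm_coord_drop i).
  have -> : l1coord i (T (I1 (w + l *: f))) = l * (1 - g).
    by rewrite -phif -[LHS]/(phi (w + l *: f)) linearD linearZ phiw add0r.
  have -> : drop_coord i (T (I1 (w + l *: f))) = drop_coord i (T (I1 w - l *: q)).
    suff -> : T (I1 (w + l *: f)) = T (I1 w - l *: q) + l *: unit_coord Y i.
      by rewrite drop_coordD_unit.
    have -> : I1 (w + l *: f) = I1 w + l *: I1 f by rewrite linearD linearZ.
    rewrite linearD linearZ /= TI1f [in RHS]linearB [in RHS]linearZ /=.
    by rewrite scalerBr addrA addrAC.
  have := Te (I1 w - l *: q); rewrite [leRHS](norm_coord_drop i).
  have -> : l1coord i (T (I1 w - l *: q)) = - (l * g).
    by rewrite linearB linearZ l1coordB l1coordZ -/g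
      -[l1coord i (T (I1 w))]/(phi w) phiw sub0r.
  have -> : `|I1 w - l *: q| = `|w| + `|l| * `|s|.
    by rewrite norm_l1sum /= scaler0 subr0 sub0r normrN normrZ.
  rewrite normrN !normrM => wls.
  (* Up to the factor [|l|] and a common [|g|] this says [|f| + |g| <= |1 - g| + |s|]. It follows
     from [|1 - g| >= 1 - |g|], [|f| + |s| <= 1] and [|g| <= |s|]. *)
  have : `|l| * (`|g| + (`|f| + `|g|)) <= `|l| * (`|1 - g| + (`|s| + `|g|)).
    rewrite ler_wpM2l//.
    have gs' : `|g| <= `|s| by rewrite (le_trans gs)// gerBl sumr_ge0.
    have := ler_normB 1 (1 - g); rewrite opprB addrCA subrr addr0 normr1.
    by have := ler_normD (1 - g) g; rewrite subrK normr1; lra.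
  by lra.
have f0 : `|f| != 0.
  by apply: contraNneq phif0 => /eqP; rewrite normr_eq0 => /eqP->; rewrite linear0.
have nv0 : `|v| != 0 by rewrite normr_eq0.
(* The axes are normalised, so the upper bound is the triangle inequality; [lower] gives the other
   one. *)
exists (D \*: (span2 (`|v|^-1 *: v) (`|f|^-1 *: f))) => x /=.
rewrite normrZ ger0_norm// /span2 !scalerA norm_ell1_2; apply/andP; split.
  have := lower ((x : 'rV[R]_2) ord0 0 / `|v| *: v) ((x : 'rV[R]_2) ord0 1 / `|f|).
  rewrite linearZ phiv => /(_ (scaler0 _ _)); apply: le_trans.
  by rewrite normrZ !normrM !normfV !normr_id !divfK.
rewrite ler_wpM2l// (le_trans (ler_normD _ _))//.
by rewrite !normrZ !normfV !normr_id !divfK.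
Qed.

Lemma distortion_le_l1sum_ell1 X Y m (D : R) : has_dim X 2 -> has_dim Y 2 ->
  0 <= D <= 2 -> distortion_le (X \oplus_1 ell1 R m) (Y \oplus_1 ell1 R m) D ->
  distortion_le X Y D \/ distortion_le (ell1 R 2) X D.
Proof.
move=> X2 Y2 /andP[D0 D2]; elim: m => [|m IHm] [T TD].
  (* [ell1 R 0] is trivial, so the first component of [T] already carries all norms. *)
  left.
  pose f (x : X) := (T (x, 0)).1.
  have flin : linear f.
    move=> a x y; rewrite /f -(linearP fst) -linearP; congr (T _).1.
    by congr pair; apply/rowP => -[].
  pose F : {linear X -> Y} := HB.pack f (GRing.isLinear.Build R _ _ *:%R f flin).
  exists F => x; rewrite /F /= /f.
  have := TD (x, 0); rewrite !norm_l1sum !norm_ell1 !big_ord0 /= !addr0.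
  by [].
have [[i [j cij]]|nc] := pselect (exists i j, 1 <= `|l1coord i (T (unit_coord X j))|).
  exact: IHm (distortion_le_pivot TD D2 cij).
right; apply: (@distortion_le_ell1 X Y m D ord0 X2 Y2 T) => // j.
by rewrite ltNge; apply/negP => cj; apply: nc; exists ord0, j.
Qed.

End Elimination.

(** * Planar spaces compared with [ell1 R 2] *)

Section PlanarSpaces.
Variable R : realType.
Implicit Types X Y Z : normedModType R.

(** Applied with [a] a distance: every strictly larger [D] comes with an operator by [lt_BM_dist],
    so attainment of the infimum is not at issue. *)
Lemma ge_of_gt (a c : R) : (forall D, a < D -> c <= D) -> c <= a.
Proof.
move=> acD; rewrite leNgt; apply/negP => /[dup] ac /midf_lt[am].
by rewrite ltNge acD.
Qed.

(* An almost Auerbach basis: a pair of vectors of the unit ball whose determinant is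
   nearly maximal. *)
Lemma distortion_le_ell1_gt2 X (D : R) : has_dim X 2 -> 2 < D ->
  distortion_le (ell1 R 2) X D.
Proof.
move=> X2 D2; have [f [g [fg gf]]] := has_dim_linear_bij X2.
have [C C0 fC] := linear_coord_bounded gf fg.
pose det (x y : X) : R := f x 0 0 * f y 0 1 - f x 0 1 * f y 0 0.
pose E := [set det p.1 p.2 | p in [set p : X * X | `|p.1| <= 1 /\ `|p.2| <= 1]].
have fle x i : `|x| <= 1 -> `|f x 0 i| <= C.
  move=> x1; apply: (@le_trans _ _ `|f x|).
    by rewrite [leRHS]/Num.norm /= mx_normrE; apply/bigmax_geP; right; exists (0, i).
  by rewrite (le_trans (fC x))// -[leRHS]mulr1 ler_wpM2l// ltW.
have E_sup : has_sup E.
  split; first by exists (det 0 0); exists (0, 0); rewrite //= normr0.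
  exists (C * C + C * C) => _ [[x y] /= [x1 y1] <-].
  rewrite (le_trans (ler_norm _))// (le_trans (ler_normB _ _))// !normrM.
  by rewrite lerD// ler_pM// fle.
have detZl a x y : det (a *: x) y = a * det x y.
  by rewrite /det linearZ !mxE; ring.
have det_le x y : `|y| <= 1 -> `|det x y| <= sup E * `|x|.
  move=> y1; have [->|x0] := eqVneq x 0.
    by rewrite /det linear0 !mxE !mul0r subrr !normr0 mulr0.
  have H (z : X) : `|z| = `|x| -> det z y <= sup E * `|x|.
    move=> zx; rewrite -ler_pdivrMr ?normr_gt0//; apply: ub_le_sup; first exact: E_sup.2.
    exists (`|x|^-1 *: z, y); last exact: etrans (detZl _ _ _) (mulrC _ _).
    by rewrite /= normrZ normfV normr_id zx mulVf ?normr_eq0.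
  rewrite ler_norml H// andbT lerNl.
  have -> : - det x y = det (- x) y by rewrite -[in RHS]scaleN1r detZl mulN1r.
  by rewrite H// normrN.
(* The two coordinate basis vectors have determinant 1. *)
have s0 : 0 < sup E.
  have [u0 u1] : g (delta_mx 0 0) != 0 /\ g (delta_mx 0 1) != 0.
    by split; apply/eqP => /(congr1 f); rewrite gf linear0 => /matrixP H;
      [have := H 0 0 | have := H 0 1]; rewrite !mxE /= => /eqP; rewrite oner_eq0.
  have := @det_le (g (delta_mx 0 0)) (`|g (delta_mx 0 1)|^-1 *: g (delta_mx 0 1)).
  rewrite normrZ normfV normr_id mulVf ?normr_eq0// => /(_ (lexx _)) dle.
  have : 0 < sup E * `|g (delta_mx 0 0)|.
    apply: lt_le_trans dle; rewrite /det linearZ !mxE !gf !mxE /=.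
    by rewrite mul0r subr0 mul1r mulr1 normfV normr_id invr_gt0 normr_gt0.
  by rewrite pmulr_lgt0 ?normr_gt0.
have D0 : 0 < D by lra.
(* This margin makes the determinant of [u] and [v] exceed [2 * sup E / D]. *)
have e0 : 0 < sup E - 2 * sup E / D.
  by rewrite subr_gt0 ltr_pdivrMr// mulrC ltr_pM2l.
have [_ [[u v] /= [u1 v1] <-]] := sup_adherent e0 E_sup.
rewrite opprB addrCA subrr addr0 => duv.
exists (D \*: span2 u v) => x /=; rewrite normrZ gtr0_norm//.
rewrite /span2; set a := (x : 'rV[R]_2) ord0 0; set b := (x : 'rV[R]_2) ord0 1.
have xE : `|x| = `|a| + `|b| by rewrite norm_ell1_2.
apply/andP; split; last first.
  rewrite xE ler_wpM2l ?(ltW D0)// (le_trans (ler_normD _ _))// !normrZ.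
  by rewrite lerD// -[leRHS]mulr1 ler_wpM2l.
have duv0 : 0 < det u v by apply: lt_trans duv; rewrite divr_gt0// mulr_gt0.
have fE i : f (a *: u + b *: v) 0 i = a * f u 0 i + b * f v 0 i.
  by rewrite linearD !linearZ /= !mxE.
(* Cramer's rule: replacing [u] by [a *: u + b *: v] multiplies the determinant by [a]. Together
   with the same for [b], this bounds [|a| + |b|]. *)
have da : `|a| * det u v <= sup E * `|a *: u + b *: v|.
  rewrite -[det u v]gtr0_norm// -normrM (_ : a * _ = det (a *: u + b *: v) v) ?det_le//.
  by rewrite /det !fE; ring.
have db : `|b| * det u v <= sup E * `|a *: u + b *: v|.
  rewrite -[det u v]gtr0_norm// -normrM -[leLHS]normrN.
  rewrite (_ : - (b * _) = det (a *: u + b *: v) u) ?det_le//.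
  by rewrite /det !fE; ring.
rewrite xE -(ler_pM2r duv0).
apply: (@le_trans _ _ (2 * sup E * `|a *: u + b *: v|)).
  by rewrite mulrDl; lra.
rewrite [leRHS]mulrAC ler_wpM2r// [leRHS]mulrC -ler_pdivrMr//.
exact: ltW.
Qed.

Lemma linear_ell1_2 X (T : {linear ell1 R 2 -> X}) x :
  T x = span2 (T (delta_mx ord0 0 : 'rV[R]_2)) (T (delta_mx ord0 1 : 'rV[R]_2)) x.
Proof.
rewrite {1}(row_sum_delta (x : 'rV[R]_2)) big_ord_recl big_ord1.
by rewrite (_ : lift _ _ = 1) ?linearD ?linearZ//; apply: val_inj.
Qed.

Lemma norm_delta_ell1 m (i : 'I_m) :
  `|(delta_mx ord0 i : 'rV[R]_m) : ell1 R m| = 1.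
Proof.
rewrite norm_ell1 (bigD1 i)//= mxE !eqxx normr1 big1 ?addr0// => j ji.
by rewrite mxE (negPf ji) normr0.
Qed.

(** Operators of distortion tending to 1 have a cluster point, which is an isometry. An operator on
    [ell1 R 2] is encoded by the images of the two unit vectors, a point of the sum of two copies of
    [X]. *)
Lemma isometric_ell1 X : has_dim X 2 ->
  (forall D : R, 1 < D -> distortion_le (ell1 R 2) X D) -> isometric X (ell1 R 2).
Proof.
move=> X2 XD.
have ek k : 1 < 1 + k.+1%:R^-1 :> R by rewrite ltrDl invr_gt0.
pose T k := projT1 (cid (XD _ (ek k))).
have TP k x : `|x| <= `|T k x| <= (1 + k.+1%:R^-1) * `|x|.
  exact: projT2 (cid (XD _ (ek k))) x.
pose e i : ell1 R 2 := (delta_mx ord0 i : 'rV[R]_2).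
pose u k : X \oplus_1 X := (T k (e 0), T k (e 1)).
have k2 k : 1 + k.+1%:R^-1 <= 2 :> R.
  by rewrite -[leRHS]/(1 + 1) lerD2l invf_le1 ?ler1n.
have u4 k : `|u k| <= 4.
  have Te i : `|T k (e i)| <= 2.
    have /andP[_ /le_trans->//] := TP k (e i).
    by rewrite norm_delta_ell1 mulr1.
  by rewrite norm_l1sum /=; have := Te 0; have := Te 1; lra.
have [p pu] := bounded_seq_cluster (has_dim_l1sum X2 X2) u4.
have Tu k x : `|span2 p.1 p.2 x - T k x| <= `|u k - p| * `|x|.
  rewrite (linear_ell1_2 (T k)) norm_l1sum norm_ell1_2 /span2 /= opprD addrACA -!scalerBr.
  rewrite (le_trans (ler_normD _ _))// !normrZ.
  rewrite [`|p.1 - _|]distrC [`|p.2 - _|]distrC mulrDl !mulrDr.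
  set A := `|_ - p.1|; set B := `|_ - p.2|.
  have A0 : 0 <= A by exact: normr_ge0.
  have B0 : 0 <= B by exact: normr_ge0.
  rewrite ![A * _]mulrC ![B * _]mulrC.
  set a := `|_ ord0 0|; set b := `|_ ord0 1|.
  have : 0 <= b * A by rewrite mulr_ge0// normr_ge0.
  have : 0 <= a * B by rewrite mulr_ge0// normr_ge0.
  lra.
have eps (x : ell1 R 2) (d : R) : 0 < d ->
    `|x| - d * `|x| <= `|span2 p.1 p.2 x| <= `|x| + (2 * d) * `|x|.
  (* An index beyond [1 / d] has distortion at most [1 + d]. Choosing it with [u j] within [d] of
     [p] adds a second error [d], hence the [2 * d] above. *)
  move=> d0; pose k := Num.truncn d^-1.
  have [j kj uj] := pu d d0 k.
  have jd : j.+1%:R^-1 <= d.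
    rewrite invf_ple ?posrE// (le_trans (ltW (truncnS_gt _)))// ler_nat ltnS.
    exact: kj.
  have /andP[Tl Tr] := TP j x.
  have Tu' : `|span2 p.1 p.2 x - T j x| <= d * `|x|.
    by rewrite (le_trans (Tu j x))// ler_wpM2r// ltW.
  have Tr' : `|T j x| <= `|x| + d * `|x|.
    by rewrite (le_trans Tr)// mulrDl mul1r lerD2l ler_wpM2r.
  have t1 := ler_normD (span2 p.1 p.2 x - T j x) (T j x).
  have t2 := ler_normD (T j x - span2 p.1 p.2 x) (span2 p.1 p.2 x).
  rewrite subrK in t1; rewrite subrK distrC in t2.
  by apply/andP; split; lra.
apply: isometric_sym.
have S_iso (x : ell1 R 2) : `|span2 p.1 p.2 x| = `|x|.
  have N0 : 0 < 2 * (1 + `|x|) by rewrite mulr_gt0// ltr_pwDl.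
  (* With this [q] the total error [2 * q * |x|] stays below the prescribed [d]. *)
  have epsN (d : R) : 0 < d -> exists2 q, 0 < q & d = q * (2 * (1 + `|x|)).
    by move=> d0; exists (d / (2 * (1 + `|x|))); rewrite ?divr_gt0// divfK// gt_eqF.
  apply/eqP; rewrite eq_le; apply/andP; split; apply/ler_addgt0Pr => d /epsN[q q0 ->].
    by have /andP[_] := eps x q q0; lra.
  have : 0 <= q * `|x| by rewrite mulr_ge0// ltW.
  by have /andP[+ _] := eps x q q0; lra.
exists (span2 p.1 p.2); last exact: S_iso.
by apply: (expanding_bij (has_dim_ell1 R 2) X2) => x; rewrite S_iso.
Qed.

End PlanarSpaces.

(** * Metric properties of [BM_dist] and stability under [ell1] summands *)

Section MultiplicativeMetric.
Variable R : realType.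
Implicit Types X Y Z : normedModType R.

Lemma BM_dist_ge1 X Y n : (0 < n)%N -> has_dim X n -> has_dim Y n ->
  1 <= BM_dist X Y.
Proof.
move=> n0 Xn Yn; apply: ge_of_gt => D /(lt_BM_dist n0 Xn Yn).
exact: distortion_ge1 Xn n0.
Qed.

Lemma BM_dist_le_sym X Y n : (0 < n)%N -> has_dim X n -> has_dim Y n ->
  BM_dist Y X <= BM_dist X Y.
Proof.
move=> n0 Xn Yn; apply: ge_of_gt => D /(lt_BM_dist n0 Xn Yn) XYD.
have D0 := le_trans ler01 (distortion_ge1 Xn n0 XYD).
exact: BM_dist_le D0 Yn Xn (distortion_le_sym D0 Xn Yn XYD).
Qed.

Lemma BM_dist_sym X Y n : (0 < n)%N -> has_dim X n -> has_dim Y n ->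
  BM_dist X Y = BM_dist Y X.
Proof. by move=> n0 Xn Yn; apply/le_anti; rewrite !(@BM_dist_le_sym _ _ n). Qed.

Lemma BM_dist_triangle X Y Z n : (0 < n)%N -> has_dim X n -> has_dim Y n ->
  has_dim Z n -> BM_dist X Z <= BM_dist X Y * BM_dist Y Z.
Proof.
move=> n0 Xn Yn Zn.
have d1 (U V : normedModType R) : has_dim U n -> has_dim V n -> 0 < BM_dist U V.
  by move=> Un Vn; exact: lt_le_trans ltr01 (BM_dist_ge1 n0 Un Vn).
(* Division isolates one factor at a time, so that each distance can be replaced by a strictly
   larger bound. *)
rewrite mulrC -ler_pdivrMr ?d1//; apply: ge_of_gt => E YE.
have E0 := lt_trans (d1 _ _ Yn Zn) YE.
rewrite ler_pdivrMr ?d1// mulrC -ler_pdivrMr//.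
apply: ge_of_gt => D XD; have D0 := lt_trans (d1 _ _ Xn Yn) XD.
rewrite ler_pdivrMr//; apply: (BM_dist_le _ Xn Zn); first by rewrite ltW ?mulr_gt0.
exact: distortion_le_trans (ltW E0) (lt_BM_dist n0 Xn Yn XD) (lt_BM_dist n0 Yn Zn YE).
Qed.

Lemma distortion_le_l1sum X Y Z (D : R) : 1 <= D -> distortion_le X Y D ->
  distortion_le (X \oplus_1 Z) (Y \oplus_1 Z) D.
Proof.
move=> D1 [T TD].
pose f (p : X \oplus_1 Z) : Y \oplus_1 Z := (T p.1, p.2).
have flin : linear f by move=> a p q; rewrite /f /= linearP.
pose F : {linear (X \oplus_1 Z) -> (Y \oplus_1 Z)} :=
  HB.pack f (GRing.isLinear.Build R _ _ *:%R f flin).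
exists F => p; rewrite /F /= !norm_l1sum /= mulrDr.
have /andP[T1 T2] := TD p.1.
by rewrite lerD2r T1 lerD// ler_peMl.
Qed.

Lemma BM_dist_l1sum_ell1 X Y m : has_dim X 2 -> has_dim Y 2 ->
  BM_dist X Y <= BM_dist X (ell1 R 2) ->
  BM_dist (X \oplus_1 ell1 R m) (Y \oplus_1 ell1 R m) = BM_dist X Y.
Proof.
move=> X2 Y2 XY.
have l2 := has_dim_ell1 R 2.
have Xm := has_dim_l1sum X2 (has_dim_ell1 R m).
have Ym := has_dim_l1sum Y2 (has_dim_ell1 R m).
apply/le_anti/andP; split.
  apply: ge_of_gt => D XYD.
  have D1 : 1 <= D by rewrite (le_trans _ (ltW XYD))// (BM_dist_ge1 _ X2).
  apply: BM_dist_le Xm Ym _; first exact: le_trans D1.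
  exact: distortion_le_l1sum (lt_BM_dist _ X2 Y2 XYD).
(* Otherwise some [D] lies strictly between the two distances. It is below both [BM_dist X Y] and
   [BM_dist X (ell1 R 2)], contradicting either outcome of [distortion_le_l1sum_ell1]. *)
rewrite leNgt; apply/negP => /[dup] lt /midf_lt[].
set D := _ / 2 => D_gt D_lt.
have TD := lt_BM_dist (isT : (0 < 2 + m)%N) Xm Ym D_gt.
have D0 : 0 <= D by rewrite (le_trans ler01)// (distortion_ge1 Xm _ TD).
have D2 : D <= 2.
  rewrite (le_trans (ltW D_lt))// (le_trans XY)//.
  rewrite (@BM_dist_sym _ _ 2)//.
  apply: ge_of_gt => E E2; apply: BM_dist_le l2 X2 (distortion_le_ell1_gt2 X2 E2).
  by lra.
have [|XYD|XD] := @distortion_le_l1sum_ell1 R X Y m D X2 Y2 _ TD.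
- by rewrite D0.
- by have := BM_dist_le D0 X2 Y2 XYD; rewrite leNgt D_lt.
- have := BM_dist_le D0 l2 X2 XD; rewrite (@BM_dist_sym _ _ 2)//.
  by rewrite leNgt (lt_le_trans D_lt XY).
Qed.

End MultiplicativeMetric.

(** * Passage to isometry classes *)

Theorem corollary1p8 (R : realType) (n : nat) (hn : (3 <= n)%N) :
  (forall X : BM R 2, X <> BM_ell1 R 2 ->
     forall X1 X2 : BM R 2,
       d_BM X X1 <= d_BM X (BM_ell1 R 2) `^ (1 / 3) ->
       d_BM X X2 <= d_BM X (BM_ell1 R 2) `^ (1 / 3) ->
       d_BM (psi hn X1) (psi hn X2) = d_BM X1 X2)
  /\ local_isometric_embedding (@d_BM R 2) (@d_BM R n)
       (fun X : BM R 2 => X <> BM_ell1 R 2) (psi hn).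
Proof.
have dl X : d_BM X (BM_ell1 R 2) = BM_dist (isom_repr X) (ell1 R 2).
  by rewrite -{1}(isom_reprK X) d_BM_class.
have d1 (X Y : BM R 2) : 1 <= d_BM X Y.
  exact: BM_dist_ge1 _ (fdspaceP _) (fdspaceP _).
have main (X X1 X2 : BM R 2) : d_BM X X1 <= d_BM X (BM_ell1 R 2) `^ (1 / 3) ->
    d_BM X X2 <= d_BM X (BM_ell1 R 2) `^ (1 / 3) ->
    d_BM (psi hn X1) (psi hn X2) = d_BM X1 X2.
  set a := d_BM X (BM_ell1 R 2); set b := a `^ _ => b1 b2.
  have b3 : a = b * (b * b).
    rewrite -[RHS]/(b ^+ 3) -powR_mulrn ?powR_ge0// -powRrM mul1r mulVf ?pnatr_eq0//.
    by rewrite powRr1// (le_trans ler01 (d1 _ _)).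
  rewrite d_BM_class; apply: BM_dist_l1sum_ell1; try exact: fdspaceP.
  rewrite -dl -/(d_BM X1 X2).
  have dim (Z : BM R 2) := fdspaceP (isom_repr Z).
  have b0 : 0 < b by rewrite (lt_le_trans ltr01)// (le_trans (d1 X X1)).
  (* The distance from [X1] to [X2] through [X] is at most [b * b]. *)
  apply: (@le_trans _ _ (b * b)).
    apply: le_trans (BM_dist_triangle (isT : (0 < 2)%N) (dim X1) (dim X) (dim X2)) _.
    rewrite (@BM_dist_sym _ _ _ 2 isT (dim X1) (dim X)).
    by rewrite ler_pM// (le_trans ler01 (d1 _ _)).
  (* Multiplied by [b], the remaining bound compares [a = b ^ 3] with the path from [X] through [X1]
     to the [ell1] plane. *)
  rewrite -(ler_pM2l b0) -b3.
  apply: le_trans (BM_dist_triangle (isT : (0 < 2)%N) (dim X) (dim X1) (dim _)) _.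
  by rewrite ler_wpM2r// (le_trans ler01 (d1 _ _)).
split=> [X _|X XD]; first exact: main.
exists (d_BM X (BM_ell1 R 2) `^ (1 / 3)) => [|y z _ _ /ltW hy /ltW hz]; last exact: main hy hz.
(* The radius must exceed 1: a distance equal to 1 would make [X] isometric to [ell1 R 2]. *)
have a1 : 1 < d_BM X (BM_ell1 R 2).
  rewrite lt_neqAle d1 andbT eq_sym; apply/eqP => a1; apply: XD.
  rewrite -(isom_reprK X); apply/isom_classP.
  have l2 := has_dim_ell1 R 2; have X2 := fdspaceP (isom_repr X).
  apply: (isometric_ell1 X2) => D D1; apply: (lt_BM_dist _ l2 X2) => //.
  by rewrite (@BM_dist_sym _ _ _ 2)// -dl a1.
apply: (@le_lt_trans _ _ (1 `^ (1 / 3))); first by rewrite powR1.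
apply: gt0_ltr_powR => //.
- by rewrite nnegrE.
- by rewrite nnegrE (le_trans ler01 (d1 _ _)).
Qed.
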